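(* Let $F:\mathbb{R}^d\to\mathbb{R}^d$ be smooth. A locally exact modification of the implicit midpoint rule for $\dot x=F(x)$ is given by $$x_{n+1}-x_n=h_n\,\operatorname{tanhc}\!\left(\frac{h_nF'(\bar x)}{2}\right)F\!\left(\frac{x_{n+1}+x_n}{2}\right),$$ i.e., for sufficiently small $h_n$ (so that the matrix function is defined) this scheme is locally exact at $\bar x$, where $\bar x=\bar x_n$ is any sequence with $\bar x_n-x_n=O(h_n)$ (for instance $\bar x_n=x_n$ or $\bar x_n=\frac12(x_n+x_{n+1})$).
   Context: Notation: $F'$ is the Jacobi matrix of $F$; $h_n>0$ is the time step; $\operatorname{tanhc}(z)=z^{-1}\tanh z$, $\operatorname{tanhc}(0)=1$ (analytic at $0$); $\varphi_1(z)=(e^z-1)/z$, $\varphi_1(0)=1$. The implicit midpoint rule is $x_{n+1}-x_n=h_nF(\frac12(x_n+x_{n+1}))$; a modification of it is obtained by replacing $h_n$ by a matrix $\delta(\bar x_n,h_n)$ with $\lim_{h\to0}\delta(\bar x_n,h)/h=I$. Local exactness. Consider a one-step scheme (explicit or implicit) for $\dot x=F(x)$ whose coefficients may depend on a point $\bar x$ treated as a fixed parameter. The linearization of the scheme around $\bar x$ is obtained by substituting $x_n=\bar x+\nu_n$, $x_{n+1}=\bar x+\nu_{n+1}$ (with $\bar x$ held fixed) and keeping only terms of order at most one in $(\nu_n,\nu_{n+1})$. The linearization of the differential equation around $\bar x$ is $\dot\nu=F'(\bar x)\nu+F(\bar x)$, with $\nu=x-\bar x$; its exact discretization (the difference equation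 whose solution satisfies $\nu_n=\nu(t_n)$) is $\nu_{n+1}=e^{h_nF'(\bar x)}\nu_n+h_n\varphi_1(h_nF'(\bar x))F(\bar x)$. The scheme is locally exact at $\bar x$ if its linearization around $\bar x$, solved for $\nu_{n+1}$, is identical with this exact discretization. A scheme is locally exact if there is a sequence $\bar x_n$ with $\bar x_n-x_n=O(h_n)$ such that the scheme is locally exact at $\bar x_n$ for every $n$; the point $\bar x_n$ may be chosen depending on $x_n,x_{n+1}$, the choice being made after the linearization with $\bar x_n$ fixed.
   Formalization: The example x̄_n = (x_n + x_{n+1})/2 is stated for bounded sequences x_n that solve the scheme, since x̄_n − x_n = O(h_n) with one constant fails in general (F(x) = x with constant step); any sequence with x̄_n − x_n = O(h_n) is covered as stated. *)

(* Defs.v *)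
From HB Require Import structures.
From mathcomp Require Import all_boot all_order all_algebra.
From mathcomp Require Import all_classical all_reals all_analysis.

Set Implicit Arguments.
Unset Strict Implicit.
Unset Printing Implicit Defensive.

Import Order.TTheory GRing.Theory Num.Theory.
Import numFieldNormedType.Exports.

Local Open Scope classical_set_scope.
Local Open Scope ring_scope.

Section ScalarFunctions.
Variable R : realType.
Implicit Type z : R.

Definition tanh z := (expR z - expR (- z)) / (expR z + expR (- z)).

Definition tanhc z := if z == 0 then 1 else z^-1 * tanh z.

Definition phi1 z := if z == 0 then 1 else (expR z - 1) / z.

End ScalarFunctions.

(* The value at a matrix of a scalar function f analytic at 0 is the sum of
   its Taylor series at 0.  It is meaningful only when [mxfun_defined f A]
   holds, since [limn] of a divergent sequence is a junk value. *)
Section MatrixFunctions.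
Variables (R : realType) (d : nat).
Implicit Types (f : R -> R) (A : 'M[R]_d).

Definition mxfun_series f A : nat -> 'M[R]_d :=
  series (fun k => (derive1n k f 0 / k`!%:R) *: A ^+ k).

Definition mxfun_defined f A : Prop := cvgn (mxfun_series f A).

Definition mxfun f A : 'M[R]_d := limn (mxfun_series f A).

End MatrixFunctions.

Section VectorFields.
Variables (R : realType) (d : nat).
Notation V := 'cV[R]_d.
Implicit Type F : V -> V.

Fixpoint class_C (k : nat) F : Prop :=
  match k with
  | 0 => continuous F
  | k'.+1 => (forall x, differentiable F x) /\
             forall v, class_C k' (fun x => 'D_v F x)
  end.

Definition smooth F : Prop := forall k, class_C k F.

(* The library's [jacobian] acts on row vectors from the right, i.e. is the
   transpose of the usual Jacobi matrix (dF_i / dx_j)_(i,j) used here. *)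
Definition jacobi F (x : V) : 'M[R]_d :=
  \matrix_(i, j) ('D_(delta_mx j 0) F x) i 0.

(* A scheme with parameter point xb and time step h, written as the equation
   S xb h (x_n, x_{n+1}) = 0. *)
Definition scheme := V -> R -> V * V -> V.

Definition modified_midpoint (delta : V -> R -> 'M[R]_d) F : scheme :=
  fun xb h p => p.2 - p.1 - delta xb h *m F (2^-1 *: (p.1 + p.2)).

(* The implicit midpoint rule itself is the case delta xb h = h%:M. *)
Definition is_modification (delta : V -> R -> 'M[R]_d) : Prop :=
  forall xb, (h^-1 *: delta xb h) @[h --> 0^'] --> (1%:M : 'M[R]_d).

(* Terms of order at most one in (nu, nu') of
   S xb h (xb + nu, xb + nu'), the parameter point xb being kept fixed. *)
Definition linearization (S : scheme) (xb : V) (h : R) (nu nu' : V) : V :=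
  S xb h (xb, xb) + 'd (S xb h) (xb, xb) (nu, nu').

Definition exact_step F (xb : V) (h : R) (nu : V) : V :=
  mxfun expR (h *: jacobi F xb) *m nu
  + h *: (mxfun (@phi1 R) (h *: jacobi F xb) *m F xb).

(* The equivalence says that the linearized scheme is uniquely solvable for
   nu' and that its solution is the exact discretization. *)
Definition locally_exact_at F (S : scheme) (xb : V) (h : R) : Prop :=
  differentiable (S xb h) (xb, xb) /\
  forall nu nu', linearization S xb h nu nu' = 0 <-> nu' = exact_step F xb h nu.

(* xb_n - x_n = O(h_n), with a constant uniform in n. *)
Definition O_step (h : nat -> R) (x xb : nat -> V) : Prop :=
  exists C : R, forall n, `|xb n - x n| <= C * h n.

Definition locally_exact_along F (S : scheme) (h : nat -> R)
    (x xb : nat -> V) : Prop :=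
  O_step h x xb /\ forall n, locally_exact_at F S (xb n) (h n).

Definition tanhc_defined F (xb : V) (h : R) : Prop :=
  mxfun_defined (@tanhc R) ((h / 2) *: jacobi F xb).

Definition tanhc_delta F (xb : V) (h : R) : 'M[R]_d :=
  h *: mxfun (@tanhc R) ((h / 2) *: jacobi F xb).

Definition tanhc_midpoint F : scheme := modified_midpoint (tanhc_delta F) F.

End VectorFields.

(* Main.v *)
Require Import Defs.
From HB Require Import structures.
From mathcomp Require Import all_boot all_order all_algebra.
From mathcomp Require Import all_classical all_reals all_analysis.
From mathcomp Require Import ring lra.

(** Let A be h times the Jacobi matrix, T = tanhc (A / 2), E = exp A and
P = phi1 A. Everything follows from two matrix identities,

  (E + 1) T = 2 P   [mxexp_tanhc]   and   P A = E - 1   [mxphi1_mul].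

Together they give (E + 1) (1 - T A / 2) = 2 and (E + 1) (1 + T A / 2) = 2 E.
In particular E + 1 is invertible, so multiplying the linearized scheme

  (1 - T A / 2) nu' = (1 + T A / 2) nu + h T F

by E + 1 gives an equivalent equation, and that equation is
nu' = E nu + h P F, the exact discretization [midpoint_solve].

The scalar form of the first identity, (exp z + 1) tanhc (z / 2) = 2 phi1 z,
is elementary. Read on coefficients it is a recursion, which is taken as the
definition of the Taylor coefficients of tanhc (z / 2); their bound 2 ^ k and
the product formula for series show that they sum to tanhc (z / 2) near 0,
hence that they are the derivatives of that function at 0 [taylor_tanhc]. The
same recursion yields the matrix identity. The time step is only assumed to
make the Taylor series of tanhc converge at A / 2, perhaps conditionally: the
theorem of Mertens [mertens] copes with this, because the other factor, the
exponential series, converges absolutely.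

The bound 2 ^ k also shows that T is defined and close to 1 for small h
[mxtanhc_defined, mxtanhc_near1]. For the midpoint of a bounded numerical
solution, this controls the increment x_(n+1) - x_n = h T F when h is small,
uniformly because F and its Jacobi matrix are bounded on balls; when h is not
small, boundedness of the solution suffices [tanhc_midpoint_O_step]. *)

Set Implicit Arguments.
Unset Strict Implicit.
Unset Printing Implicit Defensive.

Import Order.TTheory GRing.Theory Num.Theory.
Import numFieldNormedType.Exports.

Local Open Scope classical_set_scope.
Local Open Scope ring_scope.

(** * Products of series *)

(** Regrouping the Cauchy product by the index of the first factor leaves
partial sums of the second one; only these are known to converge in
[mertens]. *)
Lemma series_cauchy_prod (U V W : zmodType) (m : U -> V -> W)
    (mD : forall x y z, m x (y + z) = m x y + m x z)
    (u : nat -> U) (v : nat -> V) n :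
  series (fun k => \sum_(i < k.+1) m (u i) (v (k - i)%N)) n =
  \sum_(i < n) m (u i) (series v (n - i)%N).
Proof.
elim: n => [|n IHn]; first by rewrite /series/= big_geq// big_ord0.
rewrite seriesSr IHn big_ord_recr/= subnn [RHS]big_ord_recr/= subSnn.
rewrite seriesSr [series v 0]/series/= big_geq// add0r addrA; congr (_ + _).
rewrite -big_split/=; apply: eq_bigr => i _.
by rewrite subSn ?seriesSr ?mD// ltnW.
Qed.

(** Terms with a small index i meet a factor e (n - i) that tends to 0; the
others are bounded by the tail of the series of a. *)
Lemma cvg_conv_summable (R : realType) (a e : nat -> R) :
    (forall n, 0 <= a n) -> cvgn (series a) ->
    (forall n, 0 <= e n) -> e @ \oo --> 0 ->
  (\sum_(i < n) a i * e (n - i)%N) @[n --> \oo] --> 0.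
Proof.
move=> a0 ca e0 ce.
have [D D0 eD] : exists2 D, 0 < D & forall n, e n <= D.
  have [M [Mr bM]] := cvg_seq_bounded (cvgP _ ce).
  exists (`|M| + 1) => [|n]; first by rewrite ltr_wpDl.
  have := bM (`|M| + 1); rewrite (le_lt_trans (ler_norm M))// ?ltrDl//.
  by move=> /(_ isT n I) /=; rewrite ger0_norm.
apply/cvgr0Pnorm_le => eps eps0.
set S := limn (series a).
have ndS : nondecreasing_seq (series a).
  by apply: nondecreasing_series => n _ _; exact: a0.
have aS n : series a n <= S by exact: nondecreasing_cvgn_le.
have [N SN] : exists N, S - series a N <= eps / (2 * D).
  have : \forall N \near \oo, `|S - series a N| <= eps / (2 * D).
    move/cvgrPdist_le : (ca : series a @ \oo --> S); apply.
    by rewrite divr_gt0// mulr_gt0.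
  case=> N _ /(_ N (leqnn _)) h; exists N.
  by rewrite -[leLHS]ger0_norm// subr_ge0.
have cN : (\sum_(i < N) a i * e (n - i)%N) @[n --> \oo] --> 0.
  elim: (N) => [|k IHk].
    by under eq_fun do rewrite big_ord0; exact: cvg_cst.
  have -> : (fun n => \sum_(i < k.+1) a i * e (n - i)%N) =
      (fun n => \sum_(i < k) a i * e (n - i)%N) + (fun n => a k * e (n - k)%N).
    by apply/funext => n; rewrite big_ord_recr.
  rewrite -[X in _ --> X]addr0; apply: cvgD => //.
  rewrite -[X in _ --> X](mulr0 (a k)); apply: cvgMl_tmp.
  by rewrite -(cvg_shiftn k)/=; under eq_fun do rewrite addnK.
near=> n.
have Nn : (N <= n)%N by near: n; exact: nbhs_infty_ge.
have -> : \sum_(i < n) a i * e (n - i)%N =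
    \sum_(i < N) a i * e (n - i)%N + \sum_(N <= i < n) a i * e (n - i)%N.
  by rewrite -!(big_mkord xpredT (fun i => a i * e (n - i)%N)) -big_cat_nat.
rewrite (splitr eps) (le_trans (ler_normD _ _))// lerD//.
  by near: n; apply: cvgr0_norm_le => //; rewrite divr_gt0.
rewrite ger0_norm; last by apply: sumr_ge0 => i _; rewrite mulr_ge0.
rewrite (@le_trans _ _ (\sum_(N <= i < n) a i * D))//.
  by apply: ler_sum => i _; rewrite ler_wpM2l.
rewrite -mulr_suml -sub_series_geq// -ler_pdivlMr// -mulrA -invfM.
by rewrite (le_trans _ SN)// lerD2r.
Unshelve. all: by end_near. Qed.

(** The theorem of Mertens: the first series converges absolutely, the second
one possibly only conditionally. It is stated for a bounded bilinear product,
so as to apply both to numbers and to matrices. *)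
Lemma mertens (R : realType) (U V W : normedModType R)
    (m : {bilinear U -> V -> W}) (C : R) (u : nat -> U) (v : nat -> V)
    (lu : U) (lv : V) :
    (forall x y, `|m x y| <= C * `|x| * `|y|) ->
    cvgn [normed series u] -> series u @ \oo --> lu ->
    series v @ \oo --> lv ->
  series (fun k => \sum_(i < k.+1) m (u i) (v (k - i)%N)) @ \oo --> m lu lv.
Proof.
move=> mC cu ulu vlv.
have -> : series (fun k => \sum_(i < k.+1) m (u i) (v (k - i)%N)) =
    (fun n => m (series u n) lv) +
    (fun n => \sum_(i < n) m (u i) (series v (n - i)%N - lv)).
  apply/funext => n; rewrite series_cauchy_prod; last first.
    by move=> x y z; rewrite linearDr.
  rewrite /= /GRing.add/= [series u n]/series/= big_mkord linear_sumlz.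
  rewrite -big_split/=.
  by apply: eq_bigr => i _; rewrite -linearDr addrC subrK.
rewrite -[X in _ --> X]addr0; apply: cvgD.
  apply/subr_cvg0/norm_cvg0P.
  apply: (@squeeze_cvgr _ _ _ _ (cst 0)
    (fun n => C * `|series u n - lu| * `|lv|)).
  - by near=> n; rewrite normr_ge0 -linearBl mC.
  - exact: cvg_cst.
  - rewrite -(mul0r `|lv|); apply: cvgMr_tmp; rewrite -(mulr0 C).
    by apply: cvgMl_tmp; apply/norm_cvg0P/subr_cvg0.
apply/norm_cvg0P.
apply: (@squeeze_cvgr _ _ _ _ (cst 0)
  (fun n => C * \sum_(i < n) `|u i| * `|series v (n - i)%N - lv|)).
- near=> n; rewrite normr_ge0/= (le_trans (ler_norm_sum _ _ _))//.
  by rewrite mulr_sumr; apply: ler_sum => i _; rewrite mulrA mC.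
- exact: cvg_cst.
- rewrite -[X in _ --> X](mulr0 C); apply: cvgMl_tmp.
  apply: (@cvg_conv_summable R (fun i => `|u i|)
            (fun i => `|series v i - lv|)) => //.
  by apply/norm_cvg0P/subr_cvg0.
Unshelve. all: by end_near. Qed.

(** * Taylor coefficients of z |-> tanhc (z / 2) *)

Section TanhcCoefficients.
Variable R : realType.

(** The recursion for the k-th coefficient calls on all earlier ones, so the
prefixes of the sequence are built one entry at a time. *)
Fixpoint tanhc_half_prefix n : nat -> R :=
  if n is m.+1 then
    let p := tanhc_half_prefix m in
    fun k => if k == m then
      (m.+1`!%:R)^-1 - 2^-1 * \sum_(j < m) ((m - j)`!%:R)^-1 * p j
    else p k
  else fun=> 0.

Definition tanhc_half_coeff k := tanhc_half_prefix k.+1 k.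

Lemma tanhc_half_prefixE n k : (k < n)%N ->
  tanhc_half_prefix n k = tanhc_half_coeff k.
Proof.
elim: n => // n IHn; rewrite ltnS leq_eqVlt => /orP[/eqP->//|kn].
by rewrite /= (ltn_eqF kn) IHn.
Qed.

Lemma tanhc_half_coeffE k : tanhc_half_coeff k =
  (k.+1`!%:R)^-1 - 2^-1 * \sum_(j < k) ((k - j)`!%:R)^-1 * tanhc_half_coeff j.
Proof.
rewrite {1}/tanhc_half_coeff /= eqxx; congr (_ - _ * _).
by apply: eq_bigr => j _; rewrite tanhc_half_prefixE.
Qed.

(** The k-th coefficient of (exp z + 1) * tanhc (z / 2) = 2 * phi1 z. *)
Lemma tanhc_half_coeff_conv k :
  \sum_(i < k.+1) (i`!%:R)^-1 * tanhc_half_coeff (k - i) + tanhc_half_coeff k =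
  2 * (k.+1`!%:R)^-1.
Proof.
rewrite big_ord_recl/= fact0 invr1 mul1r subn0.
have -> : \sum_(i < k) ((bump 0 i)`!%:R)^-1 * tanhc_half_coeff (k - bump 0 i) =
    \sum_(j < k) ((k - j)`!%:R)^-1 * tanhc_half_coeff j.
  rewrite [RHS](reindex_inj rev_ord_inj)/=; apply: eq_bigr => i _.
  by rewrite /bump/= add1n subKn.
by have := tanhc_half_coeffE k; lra.
Qed.

Lemma invf_fact_le1 k : (k`!%:R)^-1 <= 1 :> R.
Proof. by rewrite invf_le1 ?ltr0n ?fact_gt0// ler1n fact_gt0. Qed.

(** By induction: the recursion bounds the k-th term by
1 + (1 + 2 + ... + 2 ^ (k - 1)) / 2, which is at most 2 ^ k. *)
Lemma tanhc_half_coeff_le k : `|tanhc_half_coeff k| <= 2 ^+ k.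
Proof.
elim/ltn_ind: k => k IHk; rewrite tanhc_half_coeffE.
have S : \sum_(j < k) 2 ^+ j = 2 ^+ k - 1 :> R.
  elim: (k) => [|n IHn]; first by rewrite big_ord0 expr0 subrr.
  by rewrite big_ord_recr/= IHn exprS; ring.
rewrite (le_trans (ler_normB _ _))// normrM [`|2^-1|]ger0_norm ?invr_ge0//.
rewrite [`|_^-1|]ger0_norm ?invr_ge0//.
apply: (@le_trans _ _ (1 + 2^-1 * (2 ^+ k - 1))).
  rewrite lerD ?invf_fact_le1// ler_wpM2l ?invr_ge0// -S.
  rewrite (le_trans (ler_norm_sum _ _ _))//; apply: ler_sum => j _.
  rewrite normrM ger0_norm ?invr_ge0// -[leRHS]mul1r.
  by rewrite ler_pM ?invr_ge0 ?invf_fact_le1 ?IHk.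
have : 1 <= 2 ^+ k :> R by rewrite exprn_ege1// ler1n.
lra.
Qed.

End TanhcCoefficients.

(** * Power series with geometrically bounded coefficients *)

Section PowerSeries.
Variable R : realType.
Implicit Types (c : nat -> R) (z : R).

Lemma is_cvg_geometric_bound (V : completeNormedModType R) (u : nat -> V) M r :
  0 <= r < 1 -> (forall k, `|u k| <= M * r ^+ k) -> cvgn [normed series u].
Proof.
move=> /andP[r0 r1] uM.
apply: (@series_le_cvg _ (fun k => `|u k|) (geometric M r)) => // [k|].
  by exact: le_trans (uM k).
by apply: is_cvg_geometric_series; rewrite ger0_norm.
Qed.

Lemma is_cvg_pseries_geometric c M r z : 0 <= r ->
  (forall k, `|c k| <= M * r ^+ k) -> r * `|z| < 1 -> cvgn [normed pseries c z].
Proof.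
move=> r0 cM rz; apply: (@is_cvg_geometric_bound _ _ M (r * `|z|)).
  by rewrite rz mulr_ge0.
by move=> k; rewrite normrM normrX exprMn mulrA ler_wpM2r.
Qed.

Lemma cvg_pseries0 c : pseries c 0 @ \oo --> c 0%N.
Proof.
rewrite -cvg_shiftS; apply: cvg_near_cst.
near=> n; rewrite /pseries /series/= big_nat_recl//= expr0 mulr1 big1 ?addr0//.
by move=> i _; rewrite exprS mul0r mulr0.
Unshelve. all: by end_near. Qed.

(** Doubling the ratio absorbs the factor k + 1 <= 2 ^ k. The class of
geometrically bounded coefficients is thus stable under differentiation. *)
Lemma pseries_diffs_bound c M r k : 0 <= M -> 0 <= r ->
  (forall k, `|c k| <= M * r ^+ k) ->
  `|pseries_diffs c k| <= M * r * (2 * r) ^+ k.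
Proof.
move=> M0 r0 cM; rewrite /pseries_diffs normrM normr_nat.
rewrite (le_trans (ler_wpM2l _ (cM _)))// exprMn exprS.
rewrite [leRHS](_ : _ = 2 ^+ k * (M * (r * r ^+ k))); last by ring.
rewrite ler_wpM2r ?mulr_ge0 ?exprn_ge0//.
by rewrite -natrX ler_nat ltn_expl.
Qed.

(** Two formal differentiations turn the ratio r into 4 r, so that the series
and its first two formal derivatives converge at 1 / (5 r). *)
Lemma is_derive_pseries c M r z : 0 <= M -> 0 < r ->
  (forall k, `|c k| <= M * r ^+ k) -> 5 * r * `|z| < 1 ->
  is_derive z (1 : R) (fun x => limn (pseries c x))
    (limn (pseries (pseries_diffs c) z)).
Proof.
move=> M0 r0 cM rz.
have cM1 := fun k => pseries_diffs_bound k M0 (ltW r0) cM.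
have cM2 k : `|pseries_diffs (pseries_diffs c) k| <=
    M * r * (2 * r) * (2 * (2 * r)) ^+ k.
  by apply: pseries_diffs_bound => //; rewrite mulr_ge0// ltW.
have r5 : 0 < 5 * r by rewrite mulr_gt0.
have rV a : a < 5 -> a * r * `|(5 * r)^-1| < 1.
  move=> a5; rewrite ger0_norm ?invr_ge0 ?ltW// ltr_pdivrMr// mul1r.
  by rewrite ltr_pM2r.
apply: (@pseries_snd_diffs _ _ (5 * r)^-1).
- apply: normed_cvg; apply: (is_cvg_pseries_geometric (ltW r0) cM).
  by rewrite -[r]mul1r -mulrA mulrA [X in `|(5 * X)^-1|]mul1r rV//; lra.
- apply: normed_cvg; apply: (is_cvg_pseries_geometric _ cM1).
    by rewrite mulr_ge0// ltW.
  by rewrite rV//; lra.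
- apply: normed_cvg; apply: (is_cvg_pseries_geometric _ cM2).
    by rewrite !mulr_ge0// ltW.
  by rewrite [2 * (2 * r)]mulrA rV//; lra.
- rewrite [ltRHS]ger0_norm ?invr_ge0 ?ltW// -[ltRHS]mul1r.
  by rewrite ltr_pdivlMr// mulrC.
Qed.

(** The coefficients and the function are generalized in the induction: the
derivative is again a power series near 0, with a smaller radius. *)
Lemma derive1n_pseries n c M r (f : R -> R) : 0 <= M -> 0 < r ->
  (forall k, `|c k| <= M * r ^+ k) ->
  (\forall z \near 0, f z = limn (pseries c z)) ->
  derive1n n f 0 = n`!%:R * c n.
Proof.
elim: n c M r f => [|n IHn] c M r f M0 r0 cM fc.
  rewrite derive1n0 (nbhs_singleton fc) (cvg_lim _ (@cvg_pseries0 c))//.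
  by rewrite fact0 mul1r.
rewrite derive1Sn (IHn (pseries_diffs c) (M * r) (2 * r)).
- by rewrite /pseries_diffs factS natrM mulrA [_ * n.+1%:R]mulrC.
- by rewrite mulr_ge0// ltW.
- by rewrite mulr_gt0.
- by move=> k; apply: pseries_diffs_bound => //; exact: ltW.
have fc' := near_join fc.
near=> z; rewrite derive1E.
rewrite (@near_eq_derive _ _ _ f (fun x => limn (pseries c x))).
  apply: (@derive_val _ _ _ _ _ _ _ (is_derive_pseries M0 r0 cM _)).
  rewrite -ltr_pdivlMl ?mulr_gt0// mulr1.
  by near: z; apply: (@nbhs0_lt R R); rewrite invr_gt0 mulr_gt0.
by near: z.
Unshelve. all: by end_near. Qed.

End PowerSeries.

(** * Taylor series of exp, phi1 and tanhc at 0 *)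

Section TaylorCoefficients.
Variable R : realType.
Implicit Types (c : nat -> R) (z : R).

Lemma taylor_pseries n c M r (f : R -> R) : 0 <= M -> 0 < r ->
  (forall k, `|c k| <= M * r ^+ k) ->
  (\forall z \near 0, f z = limn (pseries c z)) ->
  derive1n n f 0 / n`!%:R = c n.
Proof.
by move=> M0 r0 cM fc; rewrite (derive1n_pseries n M0 r0 cM fc) mulrC mulKf.
Qed.

Lemma norm_invf_fact k : `|(k`!%:R)^-1| <= 1 * 1 ^+ k :> R.
Proof. by rewrite expr1n mul1r ger0_norm ?invr_ge0// invf_fact_le1. Qed.

Lemma taylor_expR n : derive1n n expR 0 / n`!%:R = (n`!%:R)^-1 :> R.
Proof.
apply: (@taylor_pseries n (fun k => (k`!%:R)^-1) 1 1) => //.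
  exact: norm_invf_fact.
by near=> z; rewrite expRE.
Unshelve. all: by end_near. Qed.

Lemma phi1_pseries z :
  pseries (fun k => (k.+1`!%:R)^-1) z @ \oo --> @phi1 R z.
Proof.
rewrite /phi1; case: eqP => [->|/eqP z0].
  have := @cvg_pseries0 R (fun k => (k.+1`!%:R)^-1); rewrite invr1; apply.
have -> : pseries (fun k => (k.+1`!%:R)^-1) z =
    (fun n => (series (exp_coeff z) n.+1 - 1) / z).
  apply/funext => n; apply: (mulIf z0); rewrite mulfVK// /pseries/series/=.
  rewrite [in RHS]big_nat_recl//= /exp_coeff/= expr0 fact0 divr1 addrC addKr.
  by rewrite mulr_suml; apply: eq_bigr => i _; rewrite exprSr; ring.
apply: cvgMr_tmp; apply: cvgB; last exact: cvg_cst.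
by rewrite cvg_shiftS; exact: is_cvg_series_exp_coeff.
Qed.

Lemma taylor_phi1 n : derive1n n (@phi1 R) 0 / n`!%:R = (n.+1`!%:R)^-1 :> R.
Proof.
apply: (@taylor_pseries n (fun k => (k.+1`!%:R)^-1) 1 1) => //.
  by move=> k; rewrite expr1n mul1r ger0_norm ?invr_ge0// invf_fact_le1.
by near=> z; apply/esym/cvg_lim => //; exact: phi1_pseries.
Unshelve. all: by end_near. Qed.

(** This is tanh z = (exp (2 z) - 1) / (exp (2 z) + 1), divided by z. *)
Lemma phi1_tanhc z : (expR (2 * z) + 1) * tanhc z = 2 * phi1 (2 * z).
Proof.
rewrite /tanhc /phi1 mulf_eq0 pnatr_eq0/=; case: eqP => [->|/eqP z0].
  by rewrite mulr0 expR0; ring.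
rewrite /tanh expRN mulr_natl mulr2n expRD.
have e0 := expR_gt0 z; have : expR z * expR z + 1 != 0.
  by rewrite gt_eqF// addr_gt0// mulr_gt0.
by move=> e1; field; rewrite -mulr2n mulrn_eq0 (negbTE z0) e1 (gt_eqF e0).
Qed.

(** The power series Q of the coefficients satisfies
(exp w + 1) Q = 2 phi1 w for w = 2 z, by [mertens] and the recursion; tanhc z
satisfies the same equation, and exp w + 1 is not 0. *)
Lemma tanhc_pseries z : 4 * `|z| < 1 ->
  tanhc z = limn (pseries (fun k => 2 ^+ k * tanhc_half_coeff R k) z).
Proof.
move=> z1; set w := 2 * z.
have cw : cvgn [normed pseries (@tanhc_half_coeff R) w].
  apply: (@is_cvg_pseries_geometric _ _ 1 2) => // [k|].
    by rewrite mul1r tanhc_half_coeff_le.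
  by rewrite normrM ger0_norm//; lra.
have -> : pseries (fun k => 2 ^+ k * tanhc_half_coeff R k) z =
    pseries (@tanhc_half_coeff R) w.
  apply/funext => n; apply: eq_bigr => k _.
  by rewrite /= /w exprMn; ring.
set Q := limn _; have cQ : pseries (@tanhc_half_coeff R) w @ \oo --> Q.
  exact: normed_cvg.
have mC x y : `|x * y| <= 1 * `|x| * `|y| :> R by rewrite normrM mul1r.
have cE : cvgn [normed series (exp_coeff w)].
  by rewrite normed_series_exp_coeff; exact: is_cvg_series_exp_coeff.
have cP : (fun n => 2 * pseries (fun k => (k.+1`!%:R)^-1) w n) @ \oo -->
    2 * phi1 w.
  by apply: cvgMl_tmp; exact: phi1_pseries.
have cM := cvgD (@mertens R R R R *%R 1 _ _ _ _ mC cE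
  (is_cvg_series_exp_coeff w) cQ) cQ.
have EM : series (fun k => \sum_(i < k.+1) exp_coeff w i *
      (tanhc_half_coeff R (k - i) * w ^+ (k - i))) +
    pseries (@tanhc_half_coeff R) w =
    (fun n => 2 * pseries (fun k => (k.+1`!%:R)^-1) w n).
  rewrite /pseries -seriesD; apply/funext => n; rewrite mulr_sumr.
  apply: eq_bigr => k _ /=; rewrite mulrA -tanhc_half_coeff_conv mulrDl.
  congr (_ + _); rewrite mulr_suml; apply: eq_bigr => i _.
  have -> : w ^+ k = w ^+ i * w ^+ (k - i) by rewrite -exprD subnKC// -ltnS.
  by rewrite /exp_coeff/=; ring.
rewrite EM in cM.
have E : expR w * Q + Q = 2 * phi1 w.
  by apply: cvg_unique cP; first exact: Rhausdorff; exact: cM.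
by move: E; rewrite -phi1_tanhc -[X in _ + X]mul1r -mulrDl => /mulfI ->.
Qed.

Lemma taylor_tanhc n :
  derive1n n (@tanhc R) 0 / n`!%:R = 2 ^+ n * tanhc_half_coeff R n.
Proof.
apply: (@taylor_pseries n (fun k => 2 ^+ k * tanhc_half_coeff R k) 1 4) => //.
  move=> k; rewrite mul1r normrM ger0_norm ?exprn_ge0//.
  have -> : 4 = 2 * 2 :> R by rewrite -natrM.
  rewrite exprMn ler_pM2l ?exprn_gt0//.
  exact: tanhc_half_coeff_le.
by near=> z; apply: tanhc_pseries; rewrite -ltr_pdivlMl.
Unshelve. all: by end_near. Qed.

End TaylorCoefficients.

(** * Matrix norms and matrix functions *)

(** Completeness and the norm combine, so that absolutely convergent series of
matrices converge. *)
HB.instance Definition _ (R : realType) m n := Complete.on 'M[R]_(m, n).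

Section MatrixNorm.
Variable R : realType.

Lemma mx_norm_entry m n (A : 'M[R]_(m, n)) i j : `|A i j| <= `|A|.
Proof.
by rewrite [leRHS]/Num.Def.normr/= mx_normrE; exact: (le_bigmax _ _ (i, j)).
Qed.

Lemma mx_norm_le m n (A : 'M[R]_(m, n)) M : 0 <= M ->
  (forall i j, `|A i j| <= M) -> `|A| <= M.
Proof.
by move=> M0 AM; rewrite [leLHS]/Num.Def.normr/= mx_normrE bigmax_le.
Qed.

(** The norm is the largest modulus of an entry. It is not submultiplicative:
hence the factor n. *)
Lemma mx_norm_mulmx m n p (A : 'M[R]_(m, n)) (B : 'M[R]_(n, p)) :
  `|A *m B| <= n%:R * `|A| * `|B|.
Proof.
apply: mx_norm_le => [|i j]; first by rewrite !mulr_ge0.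
rewrite mxE (le_trans (ler_norm_sum _ _ _))//.
rewrite (@le_trans _ _ (\sum_(k < n) `|A| * `|B|))//.
  by apply: ler_sum => k _; rewrite normrM ler_pM ?mx_norm_entry.
by rewrite sumr_const card_ord -[leLHS]mulr_natl mulrA.
Qed.

Lemma mx_norm_scalar1 d : `|1%:M : 'M[R]_d| <= 1.
Proof.
by apply: mx_norm_le => // i j; rewrite mxE; case: eqP; rewrite ?normr1 ?normr0.
Qed.

Lemma mx_norm_expr d (A : 'M[R]_d) k : `|A ^+ k| <= (d%:R * `|A|) ^+ k.
Proof.
elim: k => [|k IHk]; first by rewrite !expr0 mx_norm_scalar1.
by rewrite !exprS (le_trans (mx_norm_mulmx _ _))// ler_wpM2l.
Qed.

Lemma linear_bound_continuous (U V : normedModType R) (f : {linear U -> V}) C :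
  (forall x, `|f x| <= C * `|x|) -> continuous f.
Proof.
move=> fC; apply/linear_bounded_continuous.
exists `|C|; split=> [|M CM]; first exact: num_real.
near=> x; have x1 : `|x| <= 1 by near: x; exact: nbhs0_le.
rewrite /= (le_trans (fC x))// (le_trans _ (ltW CM))//.
by rewrite (@le_trans _ _ (`|C| * `|x|)) ?ler_wpM2r ?ler_norm// ler_piMr.
Unshelve. all: by end_near. Qed.

Lemma continuous_mulmxl m n p (A : 'M[R]_(m, n)) :
  continuous (fun B : 'M[R]_(n, p) => A *m B).
Proof.
apply: (@linear_bound_continuous _ _ (mulmx A) (n%:R * `|A|)) => B.
exact: mx_norm_mulmx.
Qed.

Lemma continuous_mulmxr m n p (B : 'M[R]_(n, p)) :
  continuous (fun A : 'M[R]_(m, n) => A *m B).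
Proof.
apply: (@linear_bound_continuous _ _ (mulmxr B) (n%:R * `|B|)) => A.
by rewrite mulrAC; exact: mx_norm_mulmx.
Qed.

End MatrixNorm.

Section MatrixFunctions.
Variables (R : realType) (d : nat).
Implicit Type A : 'M[R]_d.

Lemma mxfun_seriesE (f : R -> R) c A :
  (forall n, derive1n n f 0 / n`!%:R = c n) ->
  mxfun_series f A = series (fun k => c k *: A ^+ k).
Proof.
by move=> fc; congr series; apply/funext => k; rewrite fc.
Qed.

Lemma is_cvg_mxpow_factorial c A : (forall k, `|c k| <= (k`!%:R)^-1) ->
  cvgn [normed series (fun k => c k *: A ^+ k)].
Proof.
move=> cM; apply: (@series_le_cvg _ (fun k => `|c k *: A ^+ k|)
  (exp_coeff (d%:R * `|A|))) => // [k|k|]; last exact: is_cvg_series_exp_coeff.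
  by rewrite exp_coeff_ge0.
by rewrite normrZ mulrC ler_pM ?mx_norm_expr.
Qed.

Lemma is_cvg_mxpow_geometric c A M r : 0 <= r ->
  (forall k, `|c k| <= M * r ^+ k) -> r * (d%:R * `|A|) < 1 ->
  cvgn [normed series (fun k => c k *: A ^+ k)].
Proof.
move=> r0 cM rA.
apply: (@is_cvg_geometric_bound _ _ _ M (r * (d%:R * `|A|))).
  by rewrite rA !mulr_ge0.
by move=> k; rewrite normrZ exprMn mulrA ler_pM ?mx_norm_expr.
Qed.

Lemma mx_exprZ a A k : (a *: A) ^+ k = a ^+ k *: A ^+ k.
Proof.
elim: k => [|k IHk]; first by rewrite !expr0 scale1r.
rewrite !exprS IHk; change ((a *: A) *m (a ^+ k *: A ^+ k) =
  (a * a ^+ k) *: (A *m A ^+ k)).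
by rewrite -scalemxAl -scalemxAr scalerA.
Qed.

Lemma mxfun_exp_series A :
  mxfun_series expR A = series (fun k => (k`!%:R)^-1 *: A ^+ k).
Proof. by apply: mxfun_seriesE => k; exact: taylor_expR. Qed.

Lemma mxfun_phi1_series A :
  mxfun_series (@phi1 R) A = series (fun k => (k.+1`!%:R)^-1 *: A ^+ k).
Proof. by apply: mxfun_seriesE => k; exact: taylor_phi1. Qed.

(** The powers of 2 in the Taylor coefficients of tanhc turn the powers of A
into those of 2 A. *)
Lemma mxfun_tanhc_series A :
  mxfun_series (@tanhc R) A =
  series (fun k => tanhc_half_coeff R k *: (2 *: A) ^+ k).
Proof.
rewrite (mxfun_seriesE _ (@taylor_tanhc R)); congr series; apply/funext => k.
by rewrite mx_exprZ scalerA mulrC.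
Qed.

Lemma is_cvg_mxexp A : cvgn [normed series (fun k => (k`!%:R)^-1 *: A ^+ k)].
Proof.
by apply: is_cvg_mxpow_factorial => k; rewrite ger0_norm ?invr_ge0.
Qed.

Lemma is_cvg_mxphi1 A :
  cvgn [normed series (fun k => (k.+1`!%:R)^-1 *: A ^+ k)].
Proof.
apply: is_cvg_mxpow_factorial => k; rewrite ger0_norm ?invr_ge0//.
by rewrite lef_pV2 ?posrE ?ltr0n ?fact_gt0// ler_nat leq_fact.
Qed.

Lemma cvg_mxfun_exp A :
  series (fun k => (k`!%:R)^-1 *: A ^+ k) @ \oo --> mxfun expR A.
Proof.
by rewrite /mxfun mxfun_exp_series; apply: normed_cvg; exact: is_cvg_mxexp.
Qed.

Lemma cvg_mxfun_phi1 A :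
  series (fun k => (k.+1`!%:R)^-1 *: A ^+ k) @ \oo --> mxfun (@phi1 R) A.
Proof.
by rewrite /mxfun mxfun_phi1_series; apply: normed_cvg; exact: is_cvg_mxphi1.
Qed.

(** Multiplication by A shifts the series of phi1 to that of exp, which only
loses its constant term. *)
Lemma mxphi1_mul A : mxfun (@phi1 R) A *m A = mxfun expR A - 1%:M.
Proof.
have cP : (fun n => series (fun k => (k.+1`!%:R)^-1 *: A ^+ k) n *m A)
    @ \oo --> mxfun (@phi1 R) A *m A.
  exact: (continuous_cvg _ (@continuous_mulmxr R d d d A _)
    (@cvg_mxfun_phi1 A)).
have EP : (fun n => series (fun k => (k.+1`!%:R)^-1 *: A ^+ k) n *m A) =
    (fun n => series (fun k => (k`!%:R)^-1 *: A ^+ k) n.+1 - 1%:M).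
  apply/funext => n; rewrite /series/= [in RHS]big_nat_recl//= expr0 fact0.
  rewrite invr1 scale1r addrC addKr mulmx_suml; apply: eq_bigr => k _.
  by rewrite exprSr -scalemxAl.
rewrite EP in cP; apply: (cvg_unique (@norm_hausdorff _ _) cP).
by apply: cvgB; [rewrite cvg_shiftS; exact: cvg_mxfun_exp|exact: cvg_cst].
Qed.

(** The Cauchy product of the series of exp and tanhc, with the coefficients
identified by [tanhc_half_coeff_conv]. The convergence of the series of tanhc
may be conditional. *)
Lemma mxexp_tanhc A : mxfun_defined (@tanhc R) (2^-1 *: A) ->
  (mxfun expR A + 1%:M) *m mxfun (@tanhc R) (2^-1 *: A) =
  2 *: mxfun (@phi1 R) A.
Proof.
rewrite /mxfun_defined /mxfun mxfun_tanhc_series scalerA mulfV// scale1r => cT.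
set T := limn (series (fun k => tanhc_half_coeff R k *: A ^+ k)).
rewrite -/(mxfun expR A) -/(mxfun (@phi1 R) A) mulmxDl mul1mx.
have cM := cvgD (@mertens R _ _ _ (@mulmx R d d d) d%:R _ _ _ _
  (@mx_norm_mulmx R d d d) (@is_cvg_mxexp A) (@cvg_mxfun_exp A) cT) cT.
have cP : (fun n => 2 *: series (fun k => (k.+1`!%:R)^-1 *: A ^+ k) n) @ \oo -->
    2 *: mxfun (@phi1 R) A.
  by apply: cvgZl_tmp; exact: cvg_mxfun_phi1.
have EM : series (fun k => \sum_(i < k.+1) ((i`!%:R)^-1 *: A ^+ i) *m
      (tanhc_half_coeff R (k - i) *: A ^+ (k - i))) +
    series (fun k => tanhc_half_coeff R k *: A ^+ k) =
    (fun n => 2 *: series (fun k => (k.+1`!%:R)^-1 *: A ^+ k) n).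
  rewrite -seriesD; apply/funext => n; rewrite scaler_sumr.
  apply: eq_bigr => k _ /=; rewrite scalerA -tanhc_half_coeff_conv scalerDl.
  congr (_ + _); rewrite scaler_suml; apply: eq_bigr => i _.
  have -> : A ^+ k = A ^+ i *m A ^+ (k - i).
    by rewrite -[RHS](exprD A i (k - i)) subnKC// -ltnS.
  by rewrite -scalemxAl -scalemxAr scalerA.
rewrite EM in cM; exact: (cvg_unique (@norm_hausdorff _ _) (cM _) cP).
Qed.

End MatrixFunctions.

(** * The linearized midpoint rule *)

Section LocalExactness.
Variables (R : realType) (d : nat).
Implicit Types (A : 'M[R]_d) (F : 'cV[R]_d -> 'cV[R]_d).

(** The left-hand side is the linearized scheme, with f standing for h F. Its
product with E + 1, which is invertible, is twice the difference of the two
sides of the right-hand equation. *)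
Lemma midpoint_solve A (f nu nu' : 'cV[R]_d) :
  mxfun_defined (@tanhc R) (2^-1 *: A) ->
  let T := mxfun (@tanhc R) (2^-1 *: A) in
  nu' - nu - T *m f - T *m (A *m (2^-1 *: (nu + nu'))) = 0 <->
  nu' = mxfun expR A *m nu + mxfun (@phi1 R) A *m f.
Proof.
move=> dT T; have := mxexp_tanhc dT; rewrite -/T.
have := mxphi1_mul A.
move: (mxfun expR A) (mxfun (@phi1 R) A) => E P PA ET.
have ETA : (E + 1%:M) *m (T *m A) = 2 *: (E - 1%:M).
  by rewrite mulmxA ET -scalemxAl PA.
have Eu : E + 1%:M \in unitmx.
  suff : (E + 1%:M) *m (2^-1 *: (1%:M - 2^-1 *: (T *m A))) = 1%:M.
    by case/mulmx1_unit.
  rewrite -scalemxAr mulmxBr -scalemxAr ETA mulmx1.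
  by move: 1%:M => I; apply/matrixP => i j; rewrite !mxE; field.
have key : (E + 1%:M) *m
    (nu' - nu - T *m f - T *m (A *m (2^-1 *: (nu + nu')))) =
    2 *: (nu' - (E *m nu + P *m f)).
  rewrite !mulmxBr [T *m (A *m _)]mulmxA [(E + 1%:M) *m (T *m A *m _)]mulmxA.
  rewrite ETA [(E + 1%:M) *m (T *m f)]mulmxA ET -!scalemxAl.
  rewrite -scalemxAr scalerA mulfV// scale1r !mulmxDl !mulNmx !mul1mx mulmxDr.
  rewrite !scalerBr !scalerDr !scaler_nat !mulr2n.
  apply/matrixP => i j; rewrite !mxE; ring.
split=> [e0|nu'E].
  move: key; rewrite e0 mulmx0 => /esym/eqP; rewrite scaler_eq0 pnatr_eq0/=.
  by rewrite subr_eq0 => /eqP.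
by rewrite -[LHS](mulKmx Eu) key nu'E subrr scaler0 mulmx0.
Qed.

Lemma diff_jacobi F x v : differentiable F x -> 'd F x v = jacobi F x *m v.
Proof.
move=> dF; rewrite {1}[v]matrix_sum_delta linear_sum/=; apply/matrixP => i j.
rewrite summxE !mxE; apply: eq_bigr => k _.
by rewrite big_ord1 linearZ/= !mxE deriveE// [j]ord1 mulrC.
Qed.

Lemma is_diff_mulmx m n p (M : 'M[R]_(m, n)) (x : 'M[R]_(n, p)) :
  is_diff x (mulmx M) (mulmx M).
Proof.
apply: DiffDef.
  apply: (@linear_differentiable _ _ _ (mulmx M)).
  exact: continuous_mulmxl.
by apply: (@diff_lin _ _ _ (mulmx M)); exact: continuous_mulmxl.
Qed.

Lemma is_diff_midpoint (D : 'M[R]_d) F x : differentiable F x ->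
  is_diff (x, x) (fun p => p.2 - p.1 - D *m F (2^-1 *: (p.1 + p.2)))
    (fun v => v.2 - v.1 - D *m 'd F x (2^-1 *: (v.1 + v.2))).
Proof.
move=> dF.
have xx : 2^-1 *: (x + x) = x.
  by apply/matrixP => i j; rewrite !mxE; field.
have fst1 : is_diff (x, x) (fst : 'cV[R]_d * 'cV[R]_d -> 'cV[R]_d) fst.
  apply: DiffDef; first by apply: linear_differentiable => ?; exact: cvg_fst.
  by apply: diff_lin => ?; exact: cvg_fst.
have snd1 : is_diff (x, x) (snd : 'cV[R]_d * 'cV[R]_d -> 'cV[R]_d) snd.
  apply: DiffDef; first by apply: linear_differentiable => ?; exact: cvg_snd.
  by apply: diff_lin => ?; exact: cvg_snd.
have g1 : is_diff (x, x) (2^-1 *: (fst + snd)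
    : 'cV[R]_d * 'cV[R]_d -> 'cV[R]_d) (2^-1 *: (fst + snd)).
  exact: is_diffZ.
have F1 : is_diff ((2^-1 *: (fst + snd)
    : 'cV[R]_d * 'cV[R]_d -> 'cV[R]_d) (x, x)) F ('d F x).
  by rewrite /GRing.scale/= /GRing.add/= xx; exact: differentiableP.
have DF := is_diff_comp (is_diff_comp g1 F1) (is_diff_mulmx D _).
exact: (is_diffB (is_diffB snd1 fst1) DF).
Qed.

End LocalExactness.

(** * Small time steps *)

Section TanhcNearZero.
Variables (R : realType) (d : nat).
Implicit Type A : 'M[R]_d.

Lemma tanhc_half_coeff0 : tanhc_half_coeff R 0 = 1.
Proof. by rewrite tanhc_half_coeffE big_ord0 mulr0 subr0 invr1. Qed.

Lemma mxtanhc_defined A : 2 * (d%:R * `|A|) < 1 ->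
  mxfun_defined (@tanhc R) (2^-1 *: A).
Proof.
move=> A1; rewrite /mxfun_defined mxfun_tanhc_series scalerA mulfV// scale1r.
apply: normed_cvg; apply: (@is_cvg_mxpow_geometric _ _ _ _ 1 2) => // k.
by rewrite mul1r tanhc_half_coeff_le.
Qed.

(** The constant term of the series is 1 and the others are dominated by
(2 b) ^ k with 2 b <= 1 / 2, for b = d * |A|. *)
Lemma mxtanhc_near1 A : 4 * (d%:R * `|A|) <= 1 ->
  `|mxfun (@tanhc R) (2^-1 *: A) - 1%:M| <= 4 * (d%:R * `|A|).
Proof.
set b := d%:R * `|A| => b1; have b0 : 0 <= b by rewrite mulr_ge0.
have : mxfun_defined (@tanhc R) (2^-1 *: A).
  by apply: mxtanhc_defined; rewrite -/b; lra.
rewrite /mxfun_defined /mxfun mxfun_tanhc_series scalerA mulfV// scale1r.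
set T := limn _ => cT; apply/ler_addgt0Pl => e e0.
have half n : \sum_(k < n) 2^-1 ^+ k = 2 - 2 * 2^-1 ^+ n :> R.
  elim: n => [|n IHn]; first by rewrite big_ord0 expr0 mulr1 subrr.
  by rewrite big_ord_recr/= IHn exprS; field.
have partial n :
    `|series (fun k => tanhc_half_coeff R k *: A ^+ k) n.+1 - 1%:M| <= 4 * b.
  rewrite /series/= big_nat_recl//= expr0 tanhc_half_coeff0 scale1r addrC addKr.
  rewrite big_mkord (le_trans (ler_norm_sum _ _ _))//.
  apply: (@le_trans _ _ (\sum_(k < n) 2 * b * 2^-1 ^+ k)).
    apply: ler_sum => k _; rewrite normrZ.
    apply: (@le_trans _ _ (2 ^+ k.+1 * b ^+ k.+1)).
      by rewrite ler_pM ?tanhc_half_coeff_le ?mx_norm_expr.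
    rewrite -exprMn exprS ler_wpM2l ?mulr_ge0// lerXn2r ?nnegrE ?mulr_ge0//.
    lra.
  rewrite -mulr_sumr half; have := exprn_ge0 n (_ : 0 <= 2^-1 :> R).
  nra.
move/cvgrPdist_le : (cT : _ @ \oo --> T) => /(_ e e0) [N _].
move=> /(_ N.+1 (leqnSn N)) /= TN.
rewrite -(subrK (series (fun k => tanhc_half_coeff R k *: A ^+ k) N.+1) T).
rewrite -addrA.
by rewrite (le_trans (ler_normD _ _))// lerD.
Qed.

End TanhcNearZero.

(** * Bounds on balls *)

Section CompactBounds.
Variables (R : realType) (d : nat).

Lemma continuous_trmx m n : continuous (@trmx R m n).
Proof.
apply: (@linear_bound_continuous _ _ _ (@trmx R m n) 1) => A.
by rewrite mul1r; apply: mx_norm_le => // i j; rewrite mxE mx_norm_entry.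
Qed.

(** Balls of row vectors are compact as bounded closed sets; transposition
carries this over to column vectors. *)
Lemma continuous_bounded_ball (V : normedModType R) (f : 'cV[R]_d -> V)
    (B : R) :
  continuous f -> exists2 C, 0 <= C & forall v, `|v| <= B -> `|f v| <= C.
Proof.
move=> cf; pose K := [set w : 'rV[R]_d | `|w| <= B].
have cK : compact K.
  apply: bounded_closed_compact.
    exists B; split=> [|M BM w /= wB]; first exact: num_real.
    exact: le_trans wB (ltW BM).
  apply: (@closed_comp _ _ (fun w : 'rV[R]_d => `|w|) [set r | r <= B]).
    by move=> w _; exact: norm_continuous.
  exact: closed_le.
have /compact_bounded[M [_ fM]] : compact [set f w^T | w in K].
  apply: continuous_compact cK; apply: continuous_subspaceT => w.
  by apply: continuous_comp; [exact: continuous_trmx|exact: cf].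
exists (`|M| + 1) => [|v vB]; first by rewrite addr_ge0.
apply: (fM (`|M| + 1)); first by rewrite (le_lt_trans (ler_norm M))// ltrDl.
exists v^T; rewrite ?trmxK// /K/=.
by apply: le_trans vB; apply: mx_norm_le => // i j; rewrite mxE mx_norm_entry.
Qed.

Lemma jacobi_bounded_ball (F : 'cV[R]_d -> 'cV[R]_d) (B : R) : smooth F ->
  exists2 C, 0 <= C & forall v, `|v| <= B -> `|jacobi F v| <= C.
Proof.
move=> sF.
have /fin_all_exists[C CP] (j : 'I_d) : exists C, 0 <= C /\
    forall v, `|v| <= B -> `|'D_(delta_mx j 0) F v| <= C.
  have [C C0 CP] := @continuous_bounded_ball _ ('D_(delta_mx j 0) F) B
    ((sF 1%N).2 (delta_mx j 0)).
  by exists C.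
exists (\sum_j C j) => [|v vB].
  by apply: sumr_ge0 => j _; case: (CP j).
apply: mx_norm_le => [|i j]; first by apply: sumr_ge0 => j _; case: (CP j).
rewrite mxE (le_trans (mx_norm_entry _ _ _))// (le_trans ((CP j).2 v vB))//.
rewrite (bigD1 j)//= lerDl; apply: sumr_ge0 => k _; by case: (CP k).
Qed.

End CompactBounds.

(** * The tanhc midpoint scheme *)

Section Scheme.
Variables (R : realType) (d : nat).
Implicit Type F : 'cV[R]_d -> 'cV[R]_d.

Lemma halfstepE (h : R) (M : 'M[R]_d) : (h / 2) *: M = 2^-1 *: (h *: M).
Proof. by rewrite scalerA mulrC. Qed.

Lemma tanhc_midpoint_exact F xb h : smooth F -> tanhc_defined F xb h ->
  locally_exact_at F (tanhc_midpoint F) xb h.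
Proof.
move=> sF; have dF : differentiable F xb by exact: (sF 1%N).1.
rewrite /tanhc_defined halfstepE => dT.
have [dS vS] := is_diff_midpoint (tanhc_delta F xb h) dF.
split=> // nu nu'; rewrite /linearization vS.
rewrite /exact_step scalemxAr -(midpoint_solve _ _ _ dT).
rewrite /tanhc_midpoint /modified_midpoint/= diff_jacobi// subrr add0r.
have -> : 2^-1 *: (xb + xb) = xb by apply/matrixP => i j; rewrite !mxE; field.
rewrite /tanhc_delta halfstepE; set T := mxfun _ _; set w := _ *: (nu + nu').
rewrite -[h *: T *m F xb]scalemxAl -[h *: T *m (_ *m w)]scalemxAl.
rewrite -[h *: _ *m w]scalemxAl -!scalemxAr.
by rewrite addrA [- _ + _]addrC.
Qed.

Lemma near_small_step F xb (e : R) : 0 < e ->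
  \forall h \near 0, 4 * (d%:R * `|h *: jacobi F xb|) <= e.
Proof.
move=> e0; near=> h; rewrite normrZ.
have c0 : 0 < 4 * d%:R * `|jacobi F xb| + 1 by rewrite ltr_wpDl// !mulr_ge0.
have : `|h| <= e / (4 * d%:R * `|jacobi F xb| + 1).
  by near: h; apply: (@nbhs0_le R R); rewrite divr_gt0.
rewrite ler_pdivlMr// mulrDr mulr1.
by have := normr_ge0 h; have := normr_ge0 (jacobi F xb); lra.
Unshelve. all: by end_near. Qed.

Lemma tanhc_delta_modification F : is_modification (tanhc_delta F).
Proof.
move=> xb; apply/cvgrPdist_le => e e0; near=> h.
have h0 : h != 0 by near: h; exact: nbhs_dnbhs_neq.
rewrite /tanhc_delta scalerA mulVf// scale1r halfstepE distrC.
have h1 : 4 * (d%:R * `|h *: jacobi F xb|) <= 1.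
  by near: h; apply: nbhs_dnbhs; exact: near_small_step.
rewrite (le_trans (mxtanhc_near1 h1))//.
by near: h; apply: nbhs_dnbhs; exact: near_small_step.
Unshelve. all: by end_near. Qed.

Lemma tanhc_defined_near F xb : \forall h \near 0^'+, tanhc_defined F xb h.
Proof.
suff : \forall h \near 0, tanhc_defined F xb h by move=> H; exact: cvg_within H.
near=> h; rewrite /tanhc_defined halfstepE; apply: mxtanhc_defined.
have : 4 * (d%:R * `|h *: jacobi F xb|) <= 1.
  by near: h; exact: near_small_step.
have : 0 <= d%:R * `|h *: jacobi F xb| by rewrite mulr_ge0.
lra.
Unshelve. all: by end_near. Qed.

(** If h n * c <= 1, then T is within 1 of the identity and the increment is
h n * T F; otherwise B <= B * c * h n bounds the distance. *)
Lemma tanhc_midpoint_O_step F (h : nat -> R) (x : nat -> 'cV[R]_d) (B : R) :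
    let xb n := 2^-1 *: (x n + x n.+1) in
    smooth F -> (forall n, 0 < h n) -> (forall n, `|x n| <= B) ->
    (forall n, tanhc_midpoint F (xb n) (h n) (x n, x n.+1) = 0) ->
  O_step h x xb.
Proof.
move=> xb sF h0 xB solx; have B0 : 0 <= B := le_trans (normr_ge0 _) (xB 0%N).
have xbB n : `|xb n| <= B.
  rewrite normrZ ger0_norm ?invr_ge0// ler_pdivrMl//.
  by rewrite (le_trans (ler_normD _ _))// mulr_natl mulr2n lerD.
have cF : continuous F by exact: (sF 0%N).
have [CF CF0 FB] := continuous_bounded_ball B cF.
have [CJ CJ0 JB] := jacobi_bounded_ball B sF.
pose c := 4 * d%:R * CJ + 1; have c0 : 0 < c by rewrite ltr_wpDl// !mulr_ge0.
exists (d%:R * CF + B * c) => n.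
have -> : xb n - x n = 2^-1 *: (x n.+1 - x n).
  by rewrite /xb; apply/matrixP => i j; rewrite !mxE; field.
rewrite normrZ ger0_norm ?invr_ge0// ler_pdivrMl//.
have [hc|/ltW ch] := leP (h n * c) 1; last first.
  rewrite (le_trans (ler_normB _ _))// (le_trans (lerD (xB _) (xB _)))//.
  have : 0 <= d%:R * CF * h n by rewrite !mulr_ge0// ltW.
  by have := ler_wpM2l B0 ch; lra.
have A1 : 4 * (d%:R * `|h n *: jacobi F (xb n)|) <= 1.
  rewrite normrZ gtr0_norm// (le_trans _ hc)// /c mulrDr mulr1.
  have : h n * (4 * d%:R) * `|jacobi F (xb n)| <= h n * (4 * d%:R) * CJ.
    by rewrite ler_wpM2l ?JB// !mulr_ge0// ltW.
  by have := h0 n; lra.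
have := solx n; rewrite /tanhc_midpoint /modified_midpoint/= -/(xb n).
rewrite /tanhc_delta halfstepE -scalemxAl => /eqP; rewrite subr_eq0 => /eqP ->.
rewrite normrZ gtr0_norm//; set T := mxfun _ _.
have T2 : `|T| <= 2.
  rewrite -(subrK 1%:M T) (le_trans (ler_normD _ _))//.
  have := mxtanhc_near1 A1; have := mx_norm_scalar1 R d; rewrite -/T; lra.
have : h n * `|T *m F (xb n)| <= h n * (d%:R * 2 * CF).
  rewrite (ler_wpM2l (ltW (h0 n)))// (le_trans (mx_norm_mulmx _ _))//.
  by rewrite ler_pM ?mulr_ge0 ?FB// ler_wpM2l.
have : 0 <= B * c * h n by rewrite !mulr_ge0// ltW.
lra.
Qed.

End Scheme.

Theorem mainTheorem4 (R : realType) (d : nat) (F : 'cV[R]_d -> 'cV[R]_d) :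
  smooth F ->
  [/\ (* the scheme is a modification of the implicit midpoint rule *)
      is_modification (tanhc_delta F),
      (* the matrix function is defined for small time steps *)
      forall xb : 'cV[R]_d, \forall h \near 0^'+, tanhc_defined F xb h,
      (* local exactness for any sequence xb_n with xb_n - x_n = O(h_n) *)
      forall (h : nat -> R) (x xb : nat -> 'cV[R]_d),
        (forall n, 0 < h n) ->
        O_step h x xb ->
        (forall n, tanhc_defined F (xb n) (h n)) ->
        locally_exact_along F (tanhc_midpoint F) h x xb,
      (* the choice xb_n = x_n *)
      forall (h : nat -> R) (x : nat -> 'cV[R]_d),
        (forall n, 0 < h n) ->
        (forall n, tanhc_defined F (x n) (h n)) ->
        locally_exact_along F (tanhc_midpoint F) h x x
    & (* the choice xb_n = (x_n + x_(n+1)) / 2 along a bounded solution *)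
      forall (h : nat -> R) (x : nat -> 'cV[R]_d),
        let xb n := 2^-1 *: (x n + x n.+1) in
        (forall n, 0 < h n) ->
        (exists B : R, forall n, `|x n| <= B) ->
        (forall n, tanhc_defined F (xb n) (h n)) ->
        (forall n, tanhc_midpoint F (xb n) (h n) (x n, x n.+1) = 0) ->
        locally_exact_along F (tanhc_midpoint F) h x xb].
Proof.
move=> sF; split.
- exact: tanhc_delta_modification.
- exact: tanhc_defined_near.
- by move=> h x xb _ xbO dT; split=> // n; exact: tanhc_midpoint_exact.
- move=> h x _ dT; split=> [|n]; last exact: tanhc_midpoint_exact.
  by exists 0 => n; rewrite subrr normr0 mul0r.
- move=> h x xb h0 [B xB] dT solx; split=> [|n].
    exact: tanhc_midpoint_O_step sF h0 xB solx.
  exact: tanhc_midpoint_exact.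
Qed.
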